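(* Let $X$ be a real Banach space with $\dim X\ge 2$ and let $H$ be a real Hilbert space with $\dim H\ge 2$. Then for all $\varepsilon\in[0,2]$ and $t\in[0,1]$ $$\delta_X(\varepsilon,t)\le \delta_H(\varepsilon,t)=1-\sqrt{1-t(1-t)\varepsilon^2}=\delta_H^+(\varepsilon,t)\le \delta_X^+(\varepsilon,t).$$
   Context: For a real Banach space $X$, $\partial B$ denotes its unit sphere. For $\varepsilon\in[0,2]$ and $t\in[0,1]$ define the generalized modulus of convexity and the generalized Banaś modulus by $$\delta_X(\varepsilon,t)=\inf\{1-\|tx+(1-t)y\|: x,y\in\partial B,\ \|x-y\|=\varepsilon\},$$ $$\delta_X^+(\varepsilon,t)=\sup\{1-\|tx+(1-t)y\|: x,y\in\partial B,\ \|x-y\|=\varepsilon\}.$$ *)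

(* Defs.v *)
From mathcomp Require Import all_boot all_order all_algebra.
From mathcomp Require Import all_classical all_reals all_analysis.

Set Implicit Arguments.
Unset Strict Implicit.
Unset Printing Implicit Defensive.

Import Order.TTheory GRing.Theory Num.Theory.
Import numFieldNormedType.Exports.

Local Open Scope classical_set_scope.
Local Open Scope ring_scope.

Definition linearly_independent (R : realType) (V : lmodType R) (n : nat)
    (v : 'I_n -> V) : Prop :=
  forall a : 'I_n -> R, \sum_(i < n) a i *: v i = 0 -> forall i, a i = 0.

(* V need not be finite-dimensional. *)
Definition dim_ge (R : realType) (n : nat) (V : lmodType R) : Prop :=
  exists v : 'I_n -> V, linearly_independent v.

(* A complete normed space with an inner product ip satisfying this is a real
   Hilbert space: {dot H for idfun} is the type of symmetric positive definite
   bilinear forms on H. *)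
Definition induces_norm (R : realType) (H : normedModType R)
    (ip : {dot H for idfun}) : Prop :=
  forall x : H, `|x| = Num.sqrt (ip x x).

Definition convexity_defects (R : realType) (X : normedModType R)
    (eps t : R) : set R :=
  [set r | exists x y : X, [/\ `|x| = 1, `|y| = 1, `|x - y| = eps &
                               r = 1 - `|t *: x + (1 - t) *: y| ] ].

(* For 0 <= eps <= 2, 0 <= t <= 1 and dim X >= 2 the set of defects is a
   nonempty subset of [0, 1], so the real-valued inf and sup (which are 0 by
   convention on empty or unbounded sets) are the genuine ones. *)
Definition modulus_convexity (R : realType) (X : normedModType R)
    (eps t : R) : R :=
  inf (convexity_defects X eps t).

Definition modulus_Banas (R : realType) (X : normedModType R)
    (eps t : R) : R :=
  sup (convexity_defects X eps t).

(* Main.v *)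
Require Import Defs.
From mathcomp Require Import all_boot all_order all_algebra.
From mathcomp Require Import all_classical all_reals all_analysis.
From mathcomp Require Import ring lra.
Import Order.TTheory GRing.Theory Num.Theory.
Import numFieldNormedType.Exports.
Local Open Scope classical_set_scope.
Local Open Scope ring_scope.

(** Write [r] for the square root of [1 - t (1 - t) eps ^ 2]. In a Hilbert space
the norm of [t x + (1 - t) y] equals [r] for all unit vectors [x], [y] at
distance [eps], so everything follows from one fact about an arbitrary normed
plane: there are unit vectors [x], [y] with [`|x - y| = eps] and [`|t x + (1 - t) y| = r]
exactly ([exists_chord_at_level]). In [X] such a chord puts [1 - r]
in the set of defects, whence both inequalities; in [H] it shows that this set
is not empty.

The fact is proved by an area argument in the manner of Nordlander. Turning the
chord around the unit circle with its length fixed at [eps] is not convenient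
when [t] differs from [1/2], since the point [t x + (1 - t) y] may then move
backwards. Instead the norm of this point is fixed at [r] and the length of the
chord is allowed to vary. Widening a chord at either end does not increase the
norm of its division point ([cone_norm_mono], [mix_widen_left],
[mix_widen_right]), so a chord with the prescribed norm can be chosen for every
mid-angle in such a way that both ends move counterclockwise and are Lipschitz
functions of the mid-angle ([halfspread_nonexpansive]). By convexity of the ball
the direction of the chord also turns counterclockwise ([chord_turns]).

The quadratic identity for [t x + (1 - t) y] relates the areas swept by the four
vectors [x], [y], [t x + (1 - t) y] and [y - x] during a half turn, counted with
their sign: if [S] is the area of half the ball, the first two sweep [S] each
and the third sweeps [r ^ 2 S], hence the chord vector sweeps an area [Z] with
[r ^ 2 S = t S + (1 - t) S - t (1 - t) Z], that is [Z = eps ^ 2 S]. Since its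
direction turns monotonically through a half turn, its length can be neither
always greater nor always less than [eps] ([sector_balance]), and by continuity
it is equal to [eps] somewhere.

As the norm need not be smooth, swept areas are not integrals of derivatives:
they are compared through the antiderivative of the sector area, up to errors
that are quadratic in the step ([sector_area_exists], [superquadratic_le]). *)

Set Implicit Arguments.
Unset Strict Implicit.
Unset Printing Implicit Defensive.

(** * Lipschitz functions of one real variable *)

(** The constant is global, so that the quadratic error terms below are uniform
along a whole curve; none of the curves involved need be differentiable when the
norm is not. *)
Definition lipschitz_curve (R : realType) (V : normedModType R) (f : R -> V) :=
  exists2 k : R, 0 <= k & forall a b, `|f a - f b| <= k * `|a - b|.

Definition bounded_curve (R : realType) (V : normedModType R) (f : R -> V) :=
  exists2 k : R, 0 <= k & forall a, `|f a| <= k.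

Section LipschitzCurves.
Variables (R : realType) (V : normedModType R).
Implicit Types (f g : R -> R) (u v : R -> V).

Lemma lipschitz_curve_cst (c : V) : lipschitz_curve (fun _ : R => c).
Proof. by exists 0 => // a b; rewrite subrr normr0 mul0r. Qed.

Lemma lipschitz_curve_id : lipschitz_curve (fun x : R => x).
Proof. by exists 1 => // a b; rewrite mul1r. Qed.

Lemma lipschitzN u : lipschitz_curve u -> lipschitz_curve (fun x => - u x).
Proof. by move=> [k k0 uk]; exists k => // a b; rewrite -opprD normrN. Qed.

Lemma lipschitzD u v : lipschitz_curve u -> lipschitz_curve v ->
  lipschitz_curve (fun x => u x + v x).
Proof.
move=> [k k0 uk] [l l0 vl]; exists (k + l); first exact: addr_ge0.
move=> a b; rewrite opprD addrACA mulrDl.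
by apply: (le_trans (ler_normD _ _)); exact: lerD.
Qed.

Lemma lipschitzB u v : lipschitz_curve u -> lipschitz_curve v ->
  lipschitz_curve (fun x => u x - v x).
Proof. by move=> lu /lipschitzN; exact: lipschitzD. Qed.

Lemma lipschitz_comp f u : lipschitz_curve u -> lipschitz_curve f ->
  lipschitz_curve (fun x => u (f x)).
Proof.
move=> [k k0 uk] [l l0 fl]; exists (k * l); first exact: mulr_ge0.
by move=> a b; apply: (le_trans (uk _ _)); rewrite -mulrA ler_wpM2l.
Qed.

Lemma lipschitz_norm u : lipschitz_curve u -> lipschitz_curve (fun x => `|u x|).
Proof.
move=> [k k0 uk]; exists k => // a b.
exact: le_trans (ler_dist_dist _ _) (uk _ _).
Qed.

Lemma lipschitzZ f u : lipschitz_curve f -> bounded_curve f ->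
  lipschitz_curve u -> bounded_curve u -> lipschitz_curve (fun x => f x *: u x).
Proof.
move=> [k k0 fk] [K K0 fK] [l l0 ul] [L L0 uL].
exists (K * l + k * L); first by rewrite addr_ge0 ?mulr_ge0.
move=> a b.
have -> : f a *: u a - f b *: u b = f a *: (u a - u b) + (f a - f b) *: u b.
  by rewrite scalerBr scalerBl addrA subrK.
apply: (le_trans (ler_normD _ _)); rewrite !normrZ mulrDl lerD //.
  by rewrite -mulrA ler_pM.
by rewrite mulrAC ler_pM.
Qed.

Lemma bounded_curve_cst (c : V) : bounded_curve (fun _ : R => c).
Proof. by exists `|c|. Qed.

Lemma boundedD u v : bounded_curve u -> bounded_curve v ->
  bounded_curve (fun x => u x + v x).
Proof.
move=> [k k0 uk] [l l0 vl]; exists (k + l); first exact: addr_ge0.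
by move=> a; apply: (le_trans (ler_normD _ _)); exact: lerD.
Qed.

Lemma bounded_comp f u : bounded_curve u -> bounded_curve (fun x => u (f x)).
Proof. by move=> [k k0 uk]; exists k. Qed.

Lemma boundedZ f u : bounded_curve f -> bounded_curve u ->
  bounded_curve (fun x => f x *: u x).
Proof.
move=> [k k0 fk] [l l0 ul]; exists (k * l); first exact: mulr_ge0.
by move=> a; rewrite normrZ ler_pM.
Qed.

Lemma lipschitz_continuous u : lipschitz_curve u -> continuous u.
Proof.
move=> [k k0 uk] x; apply/cvgrPdist_lt => e e0.
have k1 : 0 < k + 1 by rewrite ltr_wpDl.
near=> y; apply: (le_lt_trans (uk _ _)).
have : `|x - y| < e / (k + 1).
  by near: y; apply: cvgr_dist_lt; rewrite ?divr_gt0.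
rewrite ltr_pdivlMr // => h; apply: le_lt_trans h.
by rewrite mulrC ler_wpM2l // lerDl.
Unshelve. all: by end_near. Qed.

End LipschitzCurves.

Section LipschitzRealFunctions.
Variable R : realType.
Implicit Types f g : R -> R.

Lemma lipschitzM f g : lipschitz_curve f -> bounded_curve f ->
  lipschitz_curve g -> bounded_curve g -> lipschitz_curve (fun x => f x * g x).
Proof. exact: (@lipschitzZ R R^o). Qed.

Lemma boundedM f g : bounded_curve f -> bounded_curve g ->
  bounded_curve (fun x => f x * g x).
Proof. exact: (@boundedZ R R^o). Qed.

Lemma boundedV f (m : R) : 0 < m -> (forall x, m <= f x) ->
  bounded_curve (fun x => (f x)^-1).
Proof.
move=> m0 mf; exists m^-1 => [|a]; first by rewrite invr_ge0 ltW.
have fa0 : 0 < f a by exact: lt_le_trans (mf a).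
by rewrite ger0_norm ?invr_ge0 ?(ltW fa0) // lef_pV2.
Qed.

Lemma lipschitzV f (m : R) : 0 < m -> (forall x, m <= f x) ->
  lipschitz_curve f -> lipschitz_curve (fun x => (f x)^-1).
Proof.
move=> m0 mf [k k0 fk]; have [K K0 bK] := boundedV m0 mf.
exists (K * K * k); first by rewrite !mulr_ge0.
move=> a b.
have fn0 x : f x != 0 by rewrite gt_eqF // (lt_le_trans m0).
have -> : (f a)^-1 - (f b)^-1 = (f a)^-1 * (f b)^-1 * (f b - f a).
  by field; rewrite !fn0.
rewrite !normrM -(mulrA _ k) ler_pM ?mulr_ge0 ?ler_pM //.
by rewrite distrC.
Qed.

Lemma lipschitz_derive f (df : R -> R) (k : R) : 0 <= k ->
  (forall x : R, is_derive x 1 f (df x)) -> (forall x, `|df x| <= k) ->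
  lipschitz_curve f.
Proof.
move=> k0 fdf dfk; exists k => //.
have cf x : {for x, continuous f}.
  apply/differentiable_continuous/derivable1_diffP.
  by case: (fdf x).
have H a b : a <= b -> `|f b - f a| <= k * `|b - a|.
  move=> ab; have [|c _ ->] := MVT_segment ab (fun x _ => fdf x).
    by apply: continuous_subspaceT => x; exact: cf.
  by rewrite normrM ler_wpM2r.
move=> a b; have [ab|/ltW ba] := leP a b; last exact: H.
by rewrite distrC (distrC a); exact: H.
Qed.

Lemma lipschitz_sin : lipschitz_curve (@sin R).
Proof. by apply: (@lipschitz_derive _ cos 1) => // x; exact: cos_max. Qed.

Lemma lipschitz_cos : lipschitz_curve (@cos R).
Proof.
by apply: (@lipschitz_derive _ (fun x => - sin x) 1) => // x;
  rewrite normrN sin_max.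
Qed.

Lemma lipschitz_atan : lipschitz_curve (@atan R).
Proof.
apply: (@lipschitz_derive _ (fun x => (1 + x ^+ 2)^-1) 1) => // x.
have h : 1 <= 1 + x ^+ 2 by rewrite lerDl sqr_ge0.
rewrite ger0_norm ?invr_ge0 ?(le_trans _ h) // invf_le1 //.
exact: lt_le_trans h.
Qed.

Lemma bounded_sin : bounded_curve (@sin R).
Proof. by exists 1 => // x; exact: sin_max. Qed.

Lemma bounded_cos : bounded_curve (@cos R).
Proof. by exists 1 => // x; exact: cos_max. Qed.

(** Two mean value estimates: the derivative of [sin d - d] is [cos d - 1],
which is at most [`|d|] because the cosine is 1-Lipschitz. *)
Lemma sin_sub_id_le (d : R) : `|sin d - d| <= d ^+ 2.
Proof.
pose f (x : R) := sin x - x.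
have df (x : R) : is_derive x 1 f (cos x - 1) by apply: is_deriveB.
have cos_le (x : R) : `|cos x - 1| <= `|x|.
  have cd (y : R) : is_derive y 1 cos (- sin y) by exact: is_derive_cos.
  have cc : {within `[0, `|x|], continuous (@cos R)}.
    by apply: continuous_subspaceT => y; exact: continuous_cos.
  have [|c _] := MVT_segment (normr_ge0 x) (fun x _ => cd x); first exact: cc.
  rewrite cos0 subr0 cos_norm => ->; rewrite normrM normr_id normrN.
  by rewrite ler_piMl // sin_max.
suff H (x : R) : 0 <= x -> `|sin x - x| <= x ^+ 2.
  have [d0|/ltW d0] := leP 0 d; first exact: H.
  have := H (- d); rewrite oppr_ge0 sinN sqrrN => /(_ d0).
  by rewrite -opprD normrN.
move=> x0.
have [|c] := MVT_segment x0 (fun x _ => df x).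
  apply: continuous_subspaceT => y.
  by apply/differentiable_continuous/derivable1_diffP; case: (df y).
rewrite in_itv /= => /andP[c0 cx].
rewrite /f sin0 !subr0 => ->; rewrite normrM expr2 (ger0_norm x0) ler_wpM2r //.
by apply: le_trans (cos_le _) _; rewrite ger0_norm.
Qed.

(** A function whose increments over short steps are bounded below by a
quadratic in the step is nondecreasing: over [n] equal steps the errors add up
to a multiple of [1/n]. This replaces differentiation along curves that are
merely Lipschitz. *)
Lemma superquadratic_le (F : R -> R) (a b C d : R) : 0 < d -> a <= b ->
  (forall x y, a <= x -> x <= y -> y <= b -> y - x <= d ->
     - (C * (y - x) ^+ 2) <= F y - F x) ->
  F a <= F b.
Proof.
move=> d0 ab FC.
have step (n : nat) : (b - a) / d <= n.+1%:R ->
    - (C * (b - a) ^+ 2) <= n.+1%:R * (F b - F a).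
  move=> nd; pose h := (b - a) / n.+1%:R; pose p k := a + k%:R * h.
  have n0 : 0 < n.+1%:R :> R by [].
  have h0 : 0 <= h by rewrite divr_ge0 // subr_ge0.
  have hd : h <= d by rewrite ler_pdivrMr // mulrC -ler_pdivrMr.
  have pn : p n.+1 = b by rewrite /p mulrC divfK ?gt_eqF // addrC subrK.
  have p0 : p 0%N = a by rewrite /p mul0r addr0.
  have pS k : p k.+1 - p k = h by rewrite /p -natr1; ring.
  have -> : F b - F a = \sum_(0 <= k < n.+1) (F (p k.+1) - F (p k)).
    by rewrite (telescope_sumr (fun k => F (p k))) // pn p0.
  have -> : - (C * (b - a) ^+ 2) =
            n.+1%:R * \sum_(0 <= k < n.+1) (- (C * h ^+ 2)).
    rewrite sumr_const_nat subn0 -mulr_natl /h.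
    by field; rewrite addrC natr1 gt_eqF.
  rewrite ler_pM2l // !big_nat; apply: ler_sum => k /andP[_ kn].
  rewrite -(pS k); apply: FC; rewrite ?pS //.
  - by rewrite lerDl mulr_ge0.
  - by rewrite -subr_ge0 pS.
  - rewrite -pn lerD2l ler_wpM2r // ler_nat //.
rewrite -subr_ge0 leNgt; apply/negP => Fn.
pose x := `|(b - a) / d| + `|C * (b - a) ^+ 2| / - (F b - F a).
have Fp : 0 < - (F b - F a) by rewrite oppr_gt0.
have x0 : 0 <= x by rewrite addr_ge0 // divr_ge0 // ltW.
have := archi_boundP x0; set n := Num.Def.archi_bound x => xn.
have xn1 : x < n.+1%:R by apply: (lt_trans xn); rewrite ltr_nat.
have /step : (b - a) / d <= n.+1%:R.
  apply: le_trans (ltW xn1); apply: (le_trans (ler_norm _)).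
  by rewrite lerDl divr_ge0 // ltW.
apply/negP; rewrite -ltNge ltrNr -mulrN.
apply: (le_lt_trans (ler_norm _)); rewrite -ltr_pdivrMr //.
by apply: le_lt_trans xn1; rewrite lerDr.
Qed.

End LipschitzRealFunctions.

(** * The area of sectors of the unit ball *)

Section SectorArea.
Variables (R : realType) (N : R -> R) (kappa : R).
Hypotheses (kappa_gt0 : 0 < kappa) (N_ge : forall x, kappa <= N x)
  (N_lip : lipschitz_curve N).

(** When [N] is a norm in polar form, that is [N x] is the norm of the vector
[(cos x, sin x)], this is the determinant of the unit vectors of angles [a] and
[b]. *)
Definition polar_wedge (a b : R) : R := sin (b - a) / (N a * N b).

Lemma polar_wedgeC a b : polar_wedge b a = - polar_wedge a b.
Proof. by rewrite /polar_wedge -opprB sinN (mulrC (N b)) mulNr. Qed.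

(** [sigma] is an antiderivative of [1 / N ^ 2], that is twice the area swept by
the unit vector. By the mean value theorem the sector between two unit vectors
differs from the triangle that they span, whose double area is their wedge, by a
quantity of second order in the angle. The range of angles is bounded because
[sigma] is built as an integral from a base point. *)
Lemma sector_area_exists (M : R) : 0 < M ->
  exists sigma : R -> R, exists2 C : R, 0 <= C &
    (forall a b : R, - M <= a <= M -> - M <= b <= M ->
       `|sigma b - sigma a - polar_wedge a b| <= C * (b - a) ^+ 2) /\
    (forall a b : R, - M <= a -> a < b -> b <= M -> sigma a < sigma b).
Proof.
move=> M0; pose i (x : R) := (N x)^-1.
have [k k0 ik] := lipschitzV kappa_gt0 N_ge N_lip.
have [K K0 bK] := boundedV kappa_gt0 N_ge.
have iK x : `|i x| <= K by exact: bK.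
have i0 x : 0 < i x by rewrite invr_gt0 (lt_le_trans kappa_gt0).
pose g x := i x * i x.
have cg : continuous g.
  apply: lipschitz_continuous; apply: lipschitzM;
    by [exists k|exists K].
pose sigma x := (\int[@lebesgue_measure R]_(t in `[- M - 1, x]) g t)%R.
have dsigma (x : R) : - M <= x <= M -> is_derive x 1 sigma (g x).
  move=> /andP[Mx xM].
  have gi : (@lebesgue_measure R).-integrable `[- M - 1, M + 1] (EFin \o g).
    apply: continuous_compact_integrable; first exact: segment_compact.
    exact: continuous_subspaceT.
  have [||dF] := continuous_FTC1_closed _ gi _ (cg x).
  - by rewrite (le_lt_trans xM) // ltrDl.
  - by rewrite (lt_le_trans _ Mx) // gtrDl oppr_lt0.
  - by rewrite derive1E => <-; exact: DeriveDef.
have mvt (a b : R) : - M <= a -> a <= b -> b <= M ->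
    exists2 c, a <= c <= b & sigma b - sigma a = g c * (b - a).
  move=> Ma ab bM.
  have inM c : a <= c <= b -> - M <= c <= M.
    by move=> /andP[ac cb]; rewrite (le_trans Ma ac) (le_trans cb bM).
  have [||c cab e] := @MVT_segment R sigma g a b ab.
  - move=> c; rewrite in_itv /= => /andP[/ltW ac /ltW cb].
    by apply: dsigma; rewrite inM // ac cb.
  - apply: derivable_within_continuous => c; rewrite in_itv /= => cab.
    by case: (dsigma c (inM _ cab)).
  - by exists c; rewrite // -in_itv.
exists sigma, (K * k *+ 2 + K * K).
  by rewrite addr_ge0 ?mulrn_wge0 ?mulr_ge0.
split=> [a b|a b Ma ab bM]; last first.
  have [|c _ e] := mvt a b Ma _ bM; first exact: ltW.
  by rewrite -subr_gt0 e mulr_gt0 ?subr_gt0 // mulr_gt0.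
wlog ab : a b / a <= b => [H aM bM|].
  have [ab|/ltW ba] := leP a b; first exact: H.
  have := H _ _ ba bM aM; rewrite polar_wedgeC opprK -sqrrN opprB.
  by rewrite -normrN opprD opprB.
move=> /andP[Ma _] /andP[_ bM]; have [c /andP[ac cb] ->] := mvt a b Ma ab bM.
have -> : g c * (b - a) - polar_wedge a b =
    (i c * (i c - i b) + i b * (i c - i a)) * (b - a)
    - i a * i b * (sin (b - a) - (b - a)).
  by rewrite /polar_wedge invfM /g -/(i a) -/(i b); ring.
have ba0 : 0 <= b - a by rewrite subr_ge0.
have close x y : a <= x <= b -> a <= y <= b -> `|i x - i y| <= k * (b - a).
  move=> /andP[ax xb] /andP[ay yb]; apply: (le_trans (ik _ _)).
  by rewrite ler_wpM2l // ler_norml; lra.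
apply: (le_trans (ler_normB _ _)); rewrite [leRHS]mulrDl lerD //; last first.
  rewrite !normrM ler_pM ?mulr_ge0 ?ler_pM // ?iK //; exact: sin_sub_id_le.
rewrite normrM (ger0_norm ba0) expr2 mulrA ler_wpM2r //.
have -> : K * k *+ 2 * (b - a) = K * (k * (b - a)) + K * (k * (b - a)) by ring.
apply: (le_trans (ler_normD _ _)); rewrite !normrM.
by rewrite lerD // ler_pM // ?iK // close ?lexx ?ac ?cb ?ab.
Qed.

End SectorArea.

(** * The unit circle of a normed plane *)

Section NormedPlane.
Variables (R : realType) (X : normedModType R) (e1 e2 : X).
Hypothesis e_free : forall a b : R, a *: e1 + b *: e2 = 0 -> a = 0 /\ b = 0.

Definition dir (x : R) : X := cos x *: e1 + sin x *: e2.
Definition dnorm (x : R) : R := `|dir x|.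
Definition usphere (x : R) : X := (dnorm x)^-1 *: dir x.

Lemma dir_lipschitz : lipschitz_curve dir.
Proof.
apply: lipschitzD; apply: lipschitzZ; (exact: lipschitz_curve_cst ||
  exact: bounded_curve_cst || exact: lipschitz_sin || exact: lipschitz_cos ||
  exact: bounded_sin || exact: bounded_cos).
Qed.

Lemma dir_bounded : bounded_curve dir.
Proof.
by apply: boundedD; apply: boundedZ;
  (exact: bounded_curve_cst || exact: bounded_sin || exact: bounded_cos).
Qed.

Lemma dnorm_lipschitz : lipschitz_curve dnorm.
Proof. exact: lipschitz_norm dir_lipschitz. Qed.

(** After division by [a] the second coefficient ranges over the compact
interval [[-1, 1]], on which the norm of [u + l v] attains a positive minimum.
*)
Lemma norm_lin_comb_ge (u v : X) :
  (forall a b : R, a *: u + b *: v = 0 -> a = 0 /\ b = 0) ->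
  exists2 k : R, 0 < k & forall a b : R, `|b| <= `|a| ->
    k * `|a| <= `|a *: u + b *: v|.
Proof.
move=> uv_free; pose f (l : R) := `|u + l *: v|.
have f_lip : lipschitz_curve f.
  apply: lipschitz_norm; apply: lipschitzD; first exact: lipschitz_curve_cst.
  exists `|v| => // a b.
  by rewrite -scalerBl normrZ mulrC.
have [|c _ fc] := @EVT_min R f (-1) 1 _
    (continuous_subspaceT (lipschitz_continuous f_lip)).
  by rewrite (@le_trans _ _ 0) // ?lerN10.
exists (f c) => [|a b ba].
  rewrite normr_gt0; apply/eqP => e.
  have [] := uv_free 1 c; first by rewrite scale1r.
  by move/eqP; rewrite oner_eq0.
have [->|a0] := eqVneq a 0; first by rewrite normr0 mulr0.
have -> : a *: u + b *: v = a *: (u + (b / a) *: v).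
  by rewrite scalerDr scalerA mulrCA divff // mulr1.
rewrite normrZ mulrC ler_wpM2l // fc // in_itv /= -ler_norml.
by rewrite normrM normfV ler_pdivrMr ?normr_gt0 // mul1r.
Qed.

(** One of [cos x] and [sin x] dominates the other and is then at least [1/2] in
absolute value. *)
Lemma dnorm_ge : exists2 k : R, 0 < k & forall x, k <= dnorm x.
Proof.
have [k k0 ke] := norm_lin_comb_ge e_free.
have [|l l0 le] := @norm_lin_comb_ge e2 e1.
  by move=> a b; rewrite addrC => /e_free[].
exists (Num.min k l / 2) => [|x]; first by rewrite divr_gt0 // lt_min k0.
have half (a b : R) : a ^+ 2 + b ^+ 2 = 1 -> `|a| <= 1 -> `|b| <= `|a| ->
    2^-1 <= `|a|.
  rewrite -(real_normK (num_real a)) -(real_normK (num_real b)) => h a1 ba.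
  have : `|a| ^+ 2 <= `|a| by rewrite expr2 ler_piMl.
  have : `|b| ^+ 2 <= `|a| ^+ 2 by rewrite ler_pXn2r // nnegrE.
  lra.
have cs := cos2Dsin2 x.
have [sc|/ltW sc] := leP `|sin x| `|cos x|.
  apply: le_trans (ke _ _ sc); apply: ler_pM => //.
  - by rewrite le_min !ltW.
  - by rewrite ge_min lexx.
  - exact: half cs (cos_max x) sc.
rewrite /dnorm /dir addrC.
apply: le_trans (le _ _ sc); apply: ler_pM => //.
- by rewrite le_min !ltW.
- by rewrite ge_min lexx orbT.
- by apply: half (sin_max x) sc; rewrite addrC.
Qed.

Lemma dnorm_gt0 x : 0 < dnorm x.
Proof. by have [k k0 kN] := dnorm_ge; exact: lt_le_trans (kN x). Qed.

Lemma usphere_norm x : `|usphere x| = 1.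
Proof.
rewrite normrZ ger0_norm ?invr_ge0 ?(ltW (dnorm_gt0 x)) //.
by rewrite mulVf // gt_eqF // dnorm_gt0.
Qed.

Lemma normZ_usphere (c x : R) : `|c *: usphere x| = `|c|.
Proof. by rewrite normrZ usphere_norm mulr1. Qed.

Lemma usphere_lipschitz : lipschitz_curve usphere.
Proof.
have [k k0 kN] := dnorm_ge.
apply: lipschitzZ; [exact: lipschitzV kN dnorm_lipschitz|exact: boundedV kN
  |exact: dir_lipschitz|exact: dir_bounded].
Qed.

Lemma dirDpi x : dir (x + pi) = - dir x.
Proof. by rewrite /dir cosDpi sinDpi !scaleNr opprD. Qed.

Lemma dnormDpi x : dnorm (x + pi) = dnorm x.
Proof. by rewrite /dnorm dirDpi normrN. Qed.

Lemma usphereDpi x : usphere (x + pi) = - usphere x.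
Proof. by rewrite /usphere dnormDpi dirDpi scalerN. Qed.

Lemma dir_between a b c :
  sin (c - a) *: dir b = sin (c - b) *: dir a + sin (b - a) *: dir c.
Proof.
rewrite /dir !scalerDr !scalerA addrACA -!scalerDl; congr (_ *: _ + _ *: _);
  rewrite !sinB.
- have -> : (sin c * cos b - cos c * sin b) * cos a +
     (sin b * cos a - cos b * sin a) * cos c =
     (sin c * cos a - cos c * sin a) * cos b by ring.
  by [].
- have -> : (sin c * cos b - cos c * sin b) * sin a +
     (sin b * cos a - cos b * sin a) * sin c =
     (sin c * cos a - cos c * sin a) * sin b by ring.
  by [].
Qed.

Local Notation wedge := (polar_wedge dnorm).

(** Convexity of the unit ball: three points of the unit circle in
counterclockwise order span a triangle of nonnegative orientation. In the
relation [dir_between] this is just the triangle inequality. *)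
Lemma wedge_triangle a b c : a <= b <= a + pi -> b <= c <= b + pi ->
  wedge a c <= wedge a b + wedge b c.
Proof.
move=> /andP[ab ba] /andP[bc cb].
have sba : 0 <= sin (b - a) by apply: sin_ge0_pi; lra.
have scb : 0 <= sin (c - b) by apply: sin_ge0_pi; lra.
have Na := dnorm_gt0 a; have Nb := dnorm_gt0 b; have Nc := dnorm_gt0 c.
have : sin (c - a) * dnorm b <= sin (c - b) * dnorm a + sin (b - a) * dnorm c.
  apply: le_trans (_ : `|sin (c - a) *: dir b| <= _).
    by rewrite normrZ -/(dnorm b) ler_wpM2r ?(ltW Nb) // ler_norm.
  rewrite dir_between; apply: (le_trans (ler_normD _ _)).
  by rewrite !normrZ !ger0_norm.
move=> h; rewrite -subr_ge0.
have -> : wedge a b + wedge b c - wedge a c =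
    (sin (c - b) * dnorm a + sin (b - a) * dnorm c - sin (c - a) * dnorm b) /
    (dnorm a * dnorm b * dnorm c).
  by rewrite /polar_wedge; field; rewrite !gt_eqF.
by rewrite divr_ge0 ?subr_ge0 // !mulr_ge0 // ltW.
Qed.

Lemma usphere_cone a b c : a < b -> b < c -> c < a + pi ->
  exists l m : R,
    [/\ 0 < l, 0 < m & usphere b = l *: usphere a + m *: usphere c].
Proof.
move=> ab bc ca.
have sca : 0 < sin (c - a) by apply: sin_gt0_pi; lra.
have sba : 0 < sin (b - a) by apply: sin_gt0_pi; lra.
have scb : 0 < sin (c - b) by apply: sin_gt0_pi; lra.
have Na := dnorm_gt0 a; have Nb := dnorm_gt0 b; have Nc := dnorm_gt0 c.
exists (sin (c - b) * dnorm a / (sin (c - a) * dnorm b)).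
exists (sin (b - a) * dnorm c / (sin (c - a) * dnorm b)); split.
- by rewrite divr_gt0 // mulr_gt0.
- by rewrite divr_gt0 // mulr_gt0.
apply: (@scalerI _ _ (sin (c - a) * dnorm b)).
  by rewrite gt_eqF // mulr_gt0.
rewrite /usphere scalerA [RHS]scalerDr !scalerA.
have -> : sin (c - a) * dnorm b / dnorm b = sin (c - a).
  by field; rewrite gt_eqF.
rewrite dir_between; congr (_ *: _ + _ *: _); field; rewrite !gt_eqF //.
Qed.

End NormedPlane.

(** Among unit vectors, turning away from [u] (from [y] to [y'], where [y] lies
in the cone of [u] and [y']) does not increase the norm of [s u + m y]. If [s b
<= s + m a], then [s u + m y'] is a combination with nonnegative coefficients of
[s u + m y] and [y'], and the bound follows from the convexity of the norm on
the line of direction [u] through [y]; otherwise it is such a combination of [s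
u + m y] and [u], and two triangle inequalities suffice. *)
Lemma cone_norm_mono (R : realType) (X : normedModType R) (u y y' : X)
    (a b s m : R) : `|u| = 1 -> `|y| = 1 -> `|y'| = 1 ->
  0 <= a -> 0 < b -> y = a *: u + b *: y' -> 0 < s -> 0 < m ->
  `|s *: u + m *: y'| <= `|s *: u + m *: y|.
Proof.
move=> u1 y1 y'1 a0 b0 ey s0 m0.
have nZ (c : R) (v : X) : `|c *: v| = `|c| * `|v| by exact: normrZ.
 set g := `|_ + m *: y|.
have [sb|sb] := leP (s * b) (s + m * a).
  have sma : 0 < s + m * a by rewrite ltr_pwDl // mulr_ge0 // ltW.
  have h : s + m * a <= a * g + s * b.
    have e : (s + m * a) *: y = a *: (s *: u + m *: y) + (s * b) *: y'.
      rewrite {1}scalerDl {1}ey !scalerDr !scalerA [s * a]mulrC [a * m]mulrC.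
      by rewrite addrAC -addrA.
    have := ler_normD (a *: (s *: u + m *: y)) ((s * b) *: y').
    rewrite -e !nZ y1 y'1 !mulr1 (ger0_norm a0) (gtr0_norm sma).
    by rewrite gtr0_norm ?mulr_gt0.
  have -> : s *: u + m *: y' = (s / (s + m * a)) *: (s *: u + m *: y) +
      ((s + m * a - s * b) / (s + m * a) * m) *: y'.
    rewrite ey !scalerDr !scalerA addrA -!scalerDl -addrA -!scalerDl.
    by congr (_ *: _ + _ *: _); field; rewrite gt_eqF.
  apply: (le_trans (ler_normD _ _)); rewrite !nZ y'1 mulr1 -/g.
  rewrite ger0_norm ?(divr_ge0 (ltW s0) (ltW sma)) // ger0_norm; last first.
    by rewrite mulr_ge0 ?divr_ge0 ?subr_ge0 // ltW.
  have -> : s / (s + m * a) * g + (s + m * a - s * b) / (s + m * a) * m =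
      (s * g + (s + m * a - s * b) * m) / (s + m * a) by ring.
  rewrite ler_pdivrMr //.
  have : m * (s + m * a - s * b) <= m * (a * g).
    by rewrite ler_wpM2l ?(ltW m0) //; lra.
  by lra.
have -> : s *: u + m *: y' = b^-1 *: (s *: u + m *: y) +
    ((s * b - (s + m * a)) / b) *: u.
  rewrite ey !scalerDr !scalerA [RHS]addrC !addrA -!scalerDl.
  by congr (_ *: _ + _ *: _); field; rewrite gt_eqF.
apply: (le_trans (ler_normD _ _)); rewrite !nZ u1 mulr1 -/g.
rewrite gtr0_norm ?invr_gt0 // gtr0_norm ?divr_gt0 ?subr_gt0 //.
rewrite [b^-1 * g]mulrC -mulrDl ler_pdivrMr //.
have ba : b <= 1 + a.
  have : `|b *: y'| <= `|y| + `|a *: u|.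
    by apply: le_trans (ler_normB _ _); rewrite ey addrC addKr.
  by rewrite !nZ y1 u1 y'1 !mulr1 gtr0_norm // ger0_norm.
have gsm : s - m <= g.
  have := ler_normB (s *: u + m *: y) (m *: y).
  by rewrite addrK !nZ u1 y1 !mulr1 !gtr0_norm // -/g; lra.
have b1 : 0 <= b - 1.
  have : 0 <= m * a by rewrite mulr_ge0 // ltW.
  move=> ma; rewrite subr_ge0 leNgt; apply/negP => b1.
  have : s * b < s by rewrite gtr_pMr.
  lra.
have : (s - m) * (b - 1) <= g * (b - 1) by rewrite ler_wpM2r.
have : m * b <= m * (1 + a) by rewrite ler_wpM2l // ltW.
lra.
Qed.

(** * The curve of chords whose division point has a prescribed norm *)

Section LevelCurve.
Variables (R : realType) (X : normedModType R) (e1 e2 : X).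
Hypothesis e_free : forall a b : R, a *: e1 + b *: e2 = 0 -> a = 0 /\ b = 0.
Variables (t r : R).
Hypotheses (t_gt0 : 0 < t) (t_lt1 : t < 1).

Local Notation g := (usphere e1 e2).

Definition mix (a b : R) : R := `|t *: g a + (1 - t) *: g b|.

Lemma mix_diag a : mix a a = 1.
Proof. by rewrite /mix -scalerDl addrC subrK scale1r usphere_norm. Qed.

Lemma mix_antipodal a : mix a (a + pi) = `|2 * t - 1|.
Proof.
rewrite /mix usphereDpi scalerN -scalerBl normZ_usphere //.
by congr `|_|; ring.
Qed.

Lemma mix_le1 a b : mix a b <= 1.
Proof.
apply: (le_trans (ler_normD _ _)); rewrite !normZ_usphere //.
by rewrite !gtr0_norm ?subr_gt0 // addrC subrK.
Qed.

Lemma mix_ge a b : `|2 * t - 1| <= mix a b.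
Proof.
have := ler_dist_normD (t *: g a) ((1 - t) *: g b).
rewrite !normZ_usphere // (gtr0_norm t_gt0) (@gtr0_norm _ (1 - t)) ?subr_gt0 //.
by rewrite (_ : t - (1 - t) = 2 * t - 1) //; ring.
Qed.

Lemma mixDpi a b : mix (a + pi) (b + pi) = mix a b.
Proof. by rewrite /mix !usphereDpi !scalerN -opprD normrN. Qed.

Lemma mix_widen_right a b b' : a <= b -> b <= b' -> b' <= a + pi ->
  mix a b' <= mix a b.
Proof.
rewrite le_eqVlt => /predU1P[-> _ _|ab]; first by rewrite mix_diag mix_le1.
rewrite le_eqVlt => /predU1P[-> //|bb'].
rewrite le_eqVlt => /predU1P[->|b'a]; first by rewrite mix_antipodal mix_ge.
have [l [m [l0 m0 e]]] := usphere_cone e_free ab bb' b'a.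
by apply: (@cone_norm_mono _ _ _ _ _ l m);
  rewrite ?usphere_norm ?subr_gt0 // ltW.
Qed.

Lemma mix_widen_left a' a b : a' <= a -> a <= b -> b <= a' + pi ->
  mix a' b <= mix a b.
Proof.
rewrite le_eqVlt => /predU1P[-> //|a'a].
rewrite le_eqVlt => /predU1P[-> _|ab]; first by rewrite mix_diag mix_le1.
rewrite le_eqVlt => /predU1P[->|b'a]; first by rewrite mix_antipodal mix_ge.
have [l [m [l0 m0 e]]] := usphere_cone e_free a'a ab b'a.
rewrite /mix [t *: g a' + _]addrC [t *: g a + _]addrC.
by apply: (@cone_norm_mono _ _ _ _ _ m l);
  rewrite ?usphere_norm ?subr_gt0 1?addrC // ltW.
Qed.

(** Chords are parametrized by the mid-angle [s] and the half-angle [d] of their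
end points. Shifting the mid-angle is then controlled by widening the arc, which
moves both ends at once. *)
Definition spread (s d : R) : R := mix (s - d) (s + d).

Lemma spread_widen s s' d d' : 0 <= d -> `|s' - s| <= d' - d -> d' <= pi / 2 ->
  spread s' d' <= spread s d.
Proof.
rewrite ler_norml => d0 /andP[h1 h2] d'pi; rewrite /spread.
apply: (@le_trans _ _ (mix (s' - d') (s + d))).
  by apply: mix_widen_right; lra.
by apply: mix_widen_left; lra.
Qed.

Lemma spread_lipschitz : exists2 L : R, 0 <= L &
  forall s d d', `|spread s d - spread s d'| <= L * `|d - d'|.
Proof.
have [k k0 gk] := usphere_lipschitz e_free.
exists k => // s d d'; apply: (le_trans (ler_dist_dist _ _)).
rewrite opprD addrACA -!scalerBr; apply: (le_trans (ler_normD _ _)).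
rewrite (normrZ t) (normrZ (1 - t)) (gtr0_norm t_gt0).
rewrite (@gtr0_norm _ (1 - t)) ?subr_gt0 //.
have h1 : `|g (s - d) - g (s - d')| <= k * `|d - d'|.
  apply: (le_trans (gk _ _)); rewrite (_ : _ - _ = - (d - d')) ?normrN //; ring.
have h2 : `|g (s + d) - g (s + d')| <= k * `|d - d'|.
  apply: (le_trans (gk _ _)); rewrite (_ : _ - _ = d - d') //; ring.
have -> : k * `|d - d'| =
    t * (k * `|d - d'|) + (1 - t) * (k * `|d - d'|) by ring.
by rewrite lerD // ler_wpM2l // ?subr_ge0 ltW.
Qed.

Hypotheses (r_gt : `|2 * t - 1| < r) (r_lt1 : r < 1).

(** The least half-angle at which the division point has norm [r]. The infimum
makes a choice, which matters when the ball is not strictly convex. *)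
Definition halfspread (s : R) : R :=
  inf [set d | 0 <= d <= pi / 2 /\ spread s d <= r].

Let halfpi_ge0 : 0 <= pi / 2 :> R.
Proof. by rewrite divr_ge0 ?pi_ge0. Qed.

Lemma spread_halfpi s : spread s (pi / 2) = `|2 * t - 1|.
Proof. by rewrite /spread -(mix_antipodal (s - pi / 2)); congr mix; field. Qed.

Let level_halfpi s : [set d | 0 <= d <= pi / 2 /\ spread s d <= r] (pi / 2).
Proof. by split; [rewrite lexx halfpi_ge0|rewrite spread_halfpi ltW]. Qed.

Let level_lbound s :
  has_lbound [set d | 0 <= d <= pi / 2 /\ spread s d <= r].
Proof. by exists 0 => d [/andP[]]. Qed.

Lemma halfspread_ge0 s : 0 <= halfspread s.
Proof.
by apply: lb_le_inf; [exists (pi / 2); exact: level_halfpi|move=> d [/andP[]]].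
Qed.

Lemma halfspread_le s : halfspread s <= pi / 2.
Proof. by apply: ge_inf. Qed.

(** If the mid-angle moves by [h] and the half-angle grows by [h], the new arc
contains the old one, so the division point remains in the ball of radius [r].
Hence both ends of the chosen chord move monotonically and are Lipschitz
functions of [s]. *)
Lemma halfspread_nonexpansive s s' :
  `|halfspread s - halfspread s'| <= `|s - s'|.
Proof.
suff H a b : halfspread a - `|a - b| <= halfspread b.
  have := H s s'; have := H s' s; rewrite (distrC s') ler_norml; lra.
apply: lb_le_inf; first by exists (pi / 2); exact: level_halfpi.
move=> d [/andP[d0 dpi] dr]; rewrite lerBlDr.
have [dapi|] := leP (d + `|a - b|) (pi / 2); last first.
  by move=> /ltW; apply: le_trans; exact: halfspread_le.
apply: ge_inf => //; split; first by rewrite addr_ge0.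
by apply: le_trans dr; apply: spread_widen; rewrite // [d + _]addrC addrK distrC.
Qed.

Lemma spread_halfspread s : spread s (halfspread s) = r.
Proof.
have [L L0 GL] := spread_lipschitz.
have L1 : 0 < L + 1 by rewrite ltr_wpDl.
set D := halfspread s.
have Dr : spread s D <= r.
  apply/ler_addgt0Pr => e e0.
  have [|d [d0pi dr] dD] := @inf_adherent _ _ (e / (L + 1)) _
      (conj (ex_intro _ _ (level_halfpi s)) (level_lbound s)).
    by rewrite divr_gt0.
  have Dd : D <= d by apply: ge_inf.
  have := GL s D d; rewrite distrC ler_norml => /andP[h _].
  have h' : L * `|D - d| <= e.
    rewrite distrC ger0_norm ?subr_ge0 //.
    apply: (@le_trans _ _ ((L + 1) * (e / (L + 1)))).
      apply: ler_pM; rewrite ?subr_ge0 ?lerDl // lerBlDl; exact: ltW.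
    by rewrite mulrCA divff ?gt_eqF // mulr1.
  lra.
apply/eqP; rewrite eq_le Dr /=.
have D0 : 0 < D.
  rewrite lt_neqAle halfspread_ge0 andbT; apply/eqP => e0.
  move: Dr; rewrite -e0 /spread subr0 addr0 mix_diag => r1.
  by have := lt_le_trans r_lt1 r1; rewrite ltxx.
apply/ler_addgt0Pr => e e0.
pose h := Num.min D (e / (L + 1)).
have h0 : 0 < h by rewrite lt_min D0 divr_gt0.
have hD : h <= D by rewrite ge_min lexx.
have he : L * h <= e.
  apply: (@le_trans _ _ ((L + 1) * (e / (L + 1)))).
    by apply: ler_pM; rewrite ?lerDl ?(ltW h0) // ge_min lexx orbT.
  by rewrite mulrCA divff ?gt_eqF // mulr1.
have nlvl : r < spread s (D - h).
  rewrite ltNge; apply/negP => le_r.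
  have : D <= D - h.
    apply: ge_inf => //; split => //; rewrite subr_ge0 hD /=.
    by have := halfspread_le s; rewrite -/D; lra.
  by lra.
have := GL s D (D - h).
rewrite opprB addrCA subrr addr0 (gtr0_norm h0) ler_norml => /andP[]; lra.
Qed.

(** The norm of the division point is [1] for half-angle [0] and [`|2t - 1|] for
half-angle [pi / 2]; as it is Lipschitz in the half-angle, an intermediate value
is attained away from both. *)
Lemma halfspread_bounds : exists2 d0 : R, 0 < d0 &
  forall s, d0 <= halfspread s <= pi / 2 - d0.
Proof.
have [L L0 GL] := spread_lipschitz.
have L1 : 0 < L + 1 by rewrite ltr_wpDl.
exists (Num.min (1 - r) (r - `|2 * t - 1|) / (L + 1)).
  by rewrite divr_gt0 // lt_min !subr_gt0 r_lt1.
move=> s; set m := Num.min _ _; set D := halfspread s.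
have m1 : m <= 1 - r by rewrite ge_min lexx.
have m2 : m <= r - `|2 * t - 1| by rewrite ge_min lexx orbT.
have D0 : 0 <= D by exact: halfspread_ge0.
have Dpi : 0 <= pi / 2 - D by rewrite subr_ge0 halfspread_le.
apply/andP; split; last (rewrite lerBrDl -lerBrDr).
  rewrite ler_pdivrMr // (le_trans m1) //.
  have := GL s 0 D; rewrite /spread {1}addr0 {1}subr0 mix_diag -/(spread s D).
  rewrite spread_halfspread sub0r normrN (ger0_norm D0).
  by move=> /(le_trans (ler_norm _)) /le_trans; apply; rewrite mulrC ler_wpM2l // lerDl.
rewrite ler_pdivrMr // (le_trans m2) //.
have := GL s D (pi / 2); rewrite spread_halfpi spread_halfspread distrC.
rewrite [`|D - _|]distrC (ger0_norm Dpi) distrC.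
by move=> /(le_trans (ler_norm _)) /le_trans; apply; rewrite mulrC ler_wpM2l // lerDl.
Qed.

Lemma halfspreadDpi s : halfspread (s + pi) = halfspread s.
Proof.
congr inf; apply/funext => d; apply/propext; rewrite /= /spread.
by rewrite addrAC [s + pi + d]addrAC mixDpi.
Qed.

End LevelCurve.

(** * Area balance along the curve of chords *)

Section PolarLift.
Variable R : realType.
Implicit Types p q th : R -> R.

(** The argument of the vector of coordinates [(p, q)] in the orthonormal frame
turned by the angle [th]. As long as [p] stays positive the arctangent selects a
continuous branch, as regular as [p], [q] and [th]. *)
Definition polar_lift p q th (s : R) : R := th s + atan (q s / p s).

Lemma polar_liftE p q th s : 0 < p s -> exists2 k : R, 0 < k &
  p s * cos (th s) - q s * sin (th s) = k * cos (polar_lift p q th s) /\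
  p s * sin (th s) + q s * cos (th s) = k * sin (polar_lift p q th s).
Proof.
move=> p0; rewrite /polar_lift; set x := q s / p s.
have c0 : 0 < cos (atan x).
  by rewrite cos_atan invr_gt0 sqrtr_gt0 ltr_pwDl // sqr_ge0.
have sE : sin (atan x) = x * cos (atan x).
  by rewrite -{2}(atanK x) /tan divfK // gt_eqF.
have qE : q s = x * p s by rewrite divfK // gt_eqF.
exists (p s / cos (atan x)); first by rewrite divr_gt0.
rewrite cosD sinD sE qE; split; field; rewrite gt_eqF //.
Qed.

Lemma polar_lift_close p q th s : `|polar_lift p q th s - th s| <= pi / 2.
Proof.
rewrite /polar_lift addrC addKr ler_norml.
by rewrite (ltW (atan_gtNpi2 _)) (ltW (atan_ltpi2 _)).
Qed.

Lemma polar_lift_lipschitz p q th (m : R) : 0 < m -> (forall s, m <= p s) ->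
  lipschitz_curve p -> bounded_curve p -> lipschitz_curve q ->
  bounded_curve q -> lipschitz_curve th -> lipschitz_curve (polar_lift p q th).
Proof.
move=> m0 mp lp bp lq bq lth; apply: lipschitzD => //.
apply: (lipschitz_comp (@lipschitz_atan R)).
by apply: lipschitzM => //; [exact: lipschitzV mp lp|exact: boundedV mp].
Qed.

Lemma polar_lift_shift p q th (s T : R) : p (s + T) = p s -> q (s + T) = q s ->
  th (s + T) = th s + T ->
  polar_lift p q th (s + T) = polar_lift p q th s + T.
Proof. by rewrite /polar_lift => -> -> ->; rewrite addrAC. Qed.

Lemma sin_lower_bound (d : R) : 0 < d -> d <= pi / 2 ->
  exists2 c : R, 0 < c & forall x, d <= x <= pi - d -> c <= sin x.
Proof.
move=> d0 dpi.
have [||c cd cmin] := @EVT_min R sin d (pi - d).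
- by lra.
- by apply: continuous_subspaceT => x; exact: continuous_sin.
exists (sin c) => [|x xd]; last exact: cmin.
by move: cd; rewrite in_itv /= => /andP[dc cd]; apply: sin_gt0_pi; lra.
Qed.

End PolarLift.

Section SectorBalance.
Variables (R : realType) (X : normedModType R) (e1 e2 : X).
Hypothesis e_free : forall a b : R, a *: e1 + b *: e2 = 0 -> a = 0 /\ b = 0.

Local Notation g := (usphere e1 e2).
Local Notation N := (dnorm e1 e2).
Local Notation wedge := (polar_wedge N).

Lemma norm_comb_polar (l m a b k w : R) : 0 <= k ->
  l / N a * cos a + m / N b * cos b = k * cos w ->
  l / N a * sin a + m / N b * sin b = k * sin w ->
  `|l *: g a + m *: g b| = k * N w.
Proof.
move=> k0 hc hs.
rewrite (_ : _ + _ = k *: dir e1 e2 w); first by rewrite normrZ ger0_norm.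
rewrite /usphere !scalerA /dir !scalerDr !scalerA addrACA -!scalerDl.
by rewrite hc hs.
Qed.

Lemma wedge_coord (a b : R) :
  wedge a b = cos a / N a * (sin b / N b) - sin a / N a * (cos b / N b).
Proof.
have /gt_eqF Na := dnorm_gt0 e_free a; have /gt_eqF Nb := dnorm_gt0 e_free b.
by rewrite /polar_wedge sinB; field; rewrite Na Nb.
Qed.

Lemma wedgeDpi a b : wedge (a + pi) (b + pi) = wedge a b.
Proof.
by rewrite /polar_wedge !dnormDpi opprD addrACA subrr addr0.
Qed.

(** A half turn preserves wedges, so the increments of [sigma (x + pi) - sigma
x] are quadratic in the step and this function is constant: half of the ball has
the same area whichever diameter cuts it. *)
Lemma half_turn_area (sigma : R -> R) (C M a b : R) :
  (forall x y, - M <= x <= M -> - M <= y <= M ->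
     `|sigma y - sigma x - wedge x y| <= C * (y - x) ^+ 2) ->
  - M <= a -> a <= b -> b <= M - pi ->
  sigma (a + pi) - sigma a = sigma (b + pi) - sigma b.
Proof.
move=> sigmaP Ma ab bM; have pi0 := pi_gt0 R.
have H x y : a <= x -> x <= y -> y <= b ->
    `|(sigma (y + pi) - sigma y) - (sigma (x + pi) - sigma x)| <=
    2 * C * (y - x) ^+ 2.
  move=> ax xy yb.
  have := sigmaP x y; have := sigmaP (x + pi) (y + pi).
  rewrite wedgeDpi opprD addrACA subrr addr0 !ler_norml => h1 h2.
  have /andP[u1 u2] := h1 ltac:(lra) ltac:(lra).
  have /andP[v1 v2] := h2 ltac:(lra) ltac:(lra).
  by lra.
apply/eqP; rewrite eq_le; apply/andP; split.
  apply: (@superquadratic_le _ (fun x => sigma (x + pi) - sigma x) _ _ (2 * C) 1) => //.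
  by move=> x y ax xy yb _; have := H x y ax xy yb; rewrite ler_norml => /andP[].
rewrite -lerN2.
apply: (@superquadratic_le _ (fun x => - (sigma (x + pi) - sigma x)) _ _ (2 * C) 1) => //.
move=> x y ax xy yb _; have := H x y ax xy yb; rewrite ler_norml => /andP[_].
by lra.
Qed.

Variables (t r : R).
Hypotheses (t_gt0 : 0 < t) (t_lt1 : t < 1)
  (r_gt : `|2 * t - 1| < r) (r_lt1 : r < 1).

Local Notation D := (halfspread e1 e2 t r).
(* [al] and [be] are the angles of the ends of the chord of mid-angle [s];
further down, [om] is the angle of its division point and [ze] the direction of
the chord itself, whose length is [rho]. *)
Let al (s : R) := s - D s.
Let be (s : R) := s + D s.
Let rho (s : R) := `|g (be s) - g (al s)|.

Lemma D_lipschitz : lipschitz_curve D.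
Proof. by exists 1 => // a b; rewrite mul1r halfspread_nonexpansive. Qed.

Let al_lipschitz : lipschitz_curve al.
Proof. exact: lipschitzB (@lipschitz_curve_id R) D_lipschitz. Qed.

Let be_lipschitz : lipschitz_curve be.
Proof. exact: lipschitzD (@lipschitz_curve_id R) D_lipschitz. Qed.

Let Ninv_lipschitz f : lipschitz_curve f -> lipschitz_curve (fun s => (N (f s))^-1).
Proof.
move=> lf; have [k k0 kN] := dnorm_ge e_free.
exact: (lipschitz_comp (lipschitzV k0 kN (dnorm_lipschitz e1 e2)) lf).
Qed.

Let Ninv_bounded f : bounded_curve (fun s : R => (N (f s))^-1).
Proof.
have [k k0 kN] := dnorm_ge e_free.
by apply: (@boundedV _ (fun s => N (f s)) k) => // s.
Qed.

Lemma Ninv_ge : exists2 k : R, 0 < k & forall x, k <= (N x)^-1.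
Proof.
have [L L0 dL] := dir_bounded e1 e2.
exists (L + 1)^-1 => [|x]; first by rewrite invr_gt0 ltr_wpDl.
rewrite lef_pV2 ?posrE ?(dnorm_gt0 e_free) ?ltr_wpDl //.
by apply: (le_trans (dL x)); rewrite lerDl.
Qed.

Let comb_lipschitz (l m : R) (f h : R -> R) : lipschitz_curve f ->
  lipschitz_curve h ->
  lipschitz_curve (fun s => l / N (f s) + m / N (h s)).
Proof.
move=> lf lh; apply: lipschitzD; apply: lipschitzM;
 (exact: lipschitz_curve_cst || exact: bounded_curve_cst ||
  exact: Ninv_lipschitz || exact: Ninv_bounded).
Qed.

Let comb_bounded (l m : R) (f h : R -> R) :
  bounded_curve (fun s => l / N (f s) + m / N (h s)).
Proof.
by apply: boundedD; apply: boundedM;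
 (exact: bounded_curve_cst || exact: Ninv_bounded).
Qed.

(* [pw] and [qw] are the coordinates of the division point, [pz] and [qz] those
of the chord, in frames turned by [s] and [s + pi / 2]; in these frames the
first coordinate is positive since the half-angle lies strictly between [0] and
[pi / 2]. *)
Let pw s := (t / N (al s) + (1 - t) / N (be s)) * cos (D s).
Let qw s := ((1 - t) / N (be s) + (- t) / N (al s)) * sin (D s).
Let om := polar_lift pw qw id.

Let pz s := (1 / N (al s) + 1 / N (be s)) * sin (D s).
Let qz s := (1 / N (al s) + (- 1) / N (be s)) * cos (D s).
Let ze := polar_lift pz qz (fun s => s + pi / 2).

Let comb_ge (l m : R) (f h : R -> R) : 0 < l -> 0 < m ->
  exists2 k : R, 0 < k & forall s, k <= l / N (f s) + m / N (h s).
Proof.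
move=> l0 m0; have [k k0 kN] := Ninv_ge.
exists ((l + m) * k) => [|s]; first by rewrite mulr_gt0 // addr_gt0.
by rewrite mulrDl lerD // ler_wpM2l // ltW.
Qed.

Let sinD_cosD_ge : exists2 c : R, 0 < c &
  forall s, c <= sin (D s) /\ c <= cos (D s).
Proof.
have [d d0 dD] := halfspread_bounds e_free t_gt0 t_lt1 r_gt r_lt1.
have := dD 0; have pi0 := pi_gt0 R; move=> /andP[h1 h2].
have [|c c0 cs] := sin_lower_bound d0; first by lra.
exists c => // s; have /andP[? ?] := dD s.
by rewrite -sinDpihalf; split; apply: cs; apply/andP; split; lra.
Qed.

Let pw_ge : exists2 k : R, 0 < k & forall s, k <= pw s.
Proof.
have [c c0 cD] := sinD_cosD_ge.
have t1_gt0 : 0 < 1 - t by rewrite subr_gt0.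
have [k k0 kN] := comb_ge al be t_gt0 t1_gt0.
exists (k * c) => [|s]; first exact: mulr_gt0.
by apply: ler_pM; rewrite ?(ltW k0) ?(ltW c0) //; have [] := cD s.
Qed.

Let pz_ge : exists2 k : R, 0 < k & forall s, k <= pz s.
Proof.
have [c c0 cD] := sinD_cosD_ge.
have [k k0 kN] := comb_ge al be ltr01 ltr01.
exists (k * c) => [|s]; first exact: mulr_gt0.
by apply: ler_pM; rewrite ?(ltW k0) ?(ltW c0) //; have [] := cD s.
Qed.

Let sinD_lipschitz : lipschitz_curve (fun s => sin (D s)).
Proof. exact: lipschitz_comp (@lipschitz_sin R) D_lipschitz. Qed.

Let cosD_lipschitz : lipschitz_curve (fun s => cos (D s)).
Proof. exact: lipschitz_comp (@lipschitz_cos R) D_lipschitz. Qed.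

Let sinD_bounded : bounded_curve (fun s => sin (D s)).
Proof. exact: bounded_comp (@bounded_sin R). Qed.

Let cosD_bounded : bounded_curve (fun s => cos (D s)).
Proof. exact: bounded_comp (@bounded_cos R). Qed.

Let om_lipschitz : lipschitz_curve om.
Proof.
have [k k0 kp] := pw_ge.
apply: (polar_lift_lipschitz k0 kp); last exact: lipschitz_curve_id.
- by apply: lipschitzM => //; exact: comb_lipschitz.
- exact: boundedM.
- by apply: lipschitzM => //; exact: comb_lipschitz.
- exact: boundedM.
Qed.

Let ze_lipschitz : lipschitz_curve ze.
Proof.
have [k k0 kp] := pz_ge.
apply: (polar_lift_lipschitz k0 kp).
- by apply: lipschitzM => //; exact: comb_lipschitz.
- exact: boundedM.
- by apply: lipschitzM => //; exact: comb_lipschitz.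
- exact: boundedM.
- apply: lipschitzD; [exact: lipschitz_curve_id|exact: lipschitz_curve_cst].
Qed.

Let al_shift s : al (s + pi) = al s + pi.
Proof. by rewrite /al halfspreadDpi addrAC. Qed.

Let be_shift s : be (s + pi) = be s + pi.
Proof. by rewrite /be halfspreadDpi addrAC. Qed.

Let om_shift s : om (s + pi) = om s + pi.
Proof.
by apply: (@polar_lift_shift _ pw qw id) => //;
  rewrite /pw /qw al_shift be_shift !dnormDpi halfspreadDpi.
Qed.

Let ze_shift s : ze (s + pi) = ze s + pi.
Proof.
apply: (@polar_lift_shift _ pz qz); rewrite 1?addrAC //;
  by rewrite /pz /qz al_shift be_shift !dnormDpi halfspreadDpi.
Qed.

Lemma point_polar s :
  t / N (al s) * cos (al s) + (1 - t) / N (be s) * cos (be s) =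
    r / N (om s) * cos (om s) /\
  t / N (al s) * sin (al s) + (1 - t) / N (be s) * sin (be s) =
    r / N (om s) * sin (om s).
Proof.
have [m m0 mp] := pw_ge.
have [k k0 []] := @polar_liftE _ pw qw id s (lt_le_trans m0 (mp s)).
rewrite -/om => hc hs.
have {}hc : t / N (al s) * cos (al s) + (1 - t) / N (be s) * cos (be s) =
    k * cos (om s).
  by rewrite -hc /pw /qw /al /be cosB cosD; ring.
have {}hs : t / N (al s) * sin (al s) + (1 - t) / N (be s) * sin (be s) =
    k * sin (om s).
  by rewrite -hs /pw /qw /al /be sinB sinD; ring.
have := norm_comb_polar (ltW k0) hc hs.
have := spread_halfspread e_free t_gt0 t_lt1 r_gt r_lt1 s.
rewrite /spread /mix => -> rE.
by rewrite hc hs rE mulfK // gt_eqF // dnorm_gt0.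
Qed.

Lemma chord_polar s : 0 < rho s /\
  cos (be s) / N (be s) - cos (al s) / N (al s) = rho s / N (ze s) * cos (ze s) /\
  sin (be s) / N (be s) - sin (al s) / N (al s) = rho s / N (ze s) * sin (ze s).
Proof.
have [m m0 mp] := pz_ge.
have [k k0 []] := @polar_liftE _ pz qz (fun s => s + pi / 2) s (lt_le_trans m0 (mp s)).
rewrite -/ze cosDpihalf sinDpihalf => hc hs.
have {}hc : 1 / N (be s) * cos (be s) + (- 1) / N (al s) * cos (al s) =
    k * cos (ze s).
  by rewrite -hc /pz /qz /al /be cosB cosD; ring.
have {}hs : 1 / N (be s) * sin (be s) + (- 1) / N (al s) * sin (al s) =
    k * sin (ze s).
  by rewrite -hs /pz /qz /al /be sinB sinD; ring.
have := norm_comb_polar (ltW k0) hc hs.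
rewrite scale1r scaleN1r -/(rho s) => rhoE.
have Nz := dnorm_gt0 e_free (ze s).
rewrite rhoE mulfK ?gt_eqF // -hc -hs; split; first exact: mulr_gt0.
by split; ring.
Qed.

(** For any bilinear form, [x], [y] and their combination satisfy [Q (t x + (1 -
t) y) = t Q x + (1 - t) Q y - t (1 - t) Q (y - x)]; here the form is the
determinant of two positions of the same vector. *)
Lemma wedge_balance s s' : r ^+ 2 * wedge (om s) (om s') =
  t * wedge (al s) (al s') + (1 - t) * wedge (be s) (be s')
  - t * (1 - t) * (rho s * rho s' * wedge (ze s) (ze s')).
Proof.
have [c1 c2] := point_polar s; have [c1' c2'] := point_polar s'.
have [_ [z1 z2]] := chord_polar s; have [_ [z1' z2']] := chord_polar s'.
rewrite !wedge_coord.
have -> : r ^+ 2 * (cos (om s) / N (om s) * (sin (om s') / N (om s')) -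
    sin (om s) / N (om s) * (cos (om s') / N (om s'))) =
   (r / N (om s) * cos (om s)) * (r / N (om s') * sin (om s')) -
   (r / N (om s) * sin (om s)) * (r / N (om s') * cos (om s')) by ring.
have -> : rho s * rho s' * (cos (ze s) / N (ze s) * (sin (ze s') / N (ze s')) -
    sin (ze s) / N (ze s) * (cos (ze s') / N (ze s'))) =
   (rho s / N (ze s) * cos (ze s)) * (rho s' / N (ze s') * sin (ze s')) -
   (rho s / N (ze s) * sin (ze s)) * (rho s' / N (ze s') * cos (ze s')) by ring.
by rewrite -c1 -c2 -c1' -c2' -z1 -z2 -z1' -z2'; ring.
Qed.

(** The determinant of two nearby chords [(x, y)] and [(x', y')] is the sum of
the orientations of the triangles [x, y, y'] and [x, x', y]; these are
nonnegative because both ends move counterclockwise on the unit circle. *)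
Lemma chord_turns : exists2 d : R, 0 < d & forall s s', s <= s' -> s' - s <= d ->
  0 <= wedge (ze s) (ze s').
Proof.
have [d d0 dD] := halfspread_bounds e_free t_gt0 t_lt1 r_gt r_lt1.
exists d => // s s' ss' ss'd.
have [rho0 [z1 z2]] := chord_polar s; have [rho0' [z1' z2']] := chord_polar s'.
have /andP[h1 h2] := dD s; have /andP[h1' h2'] := dD s'.
have := halfspread_nonexpansive e_free t_gt0 t_lt1 r_gt s s'.
rewrite [`|s - s'|]distrC (ger0_norm (_ : 0 <= s' - s)) ?subr_ge0 // ler_norml.
move=> /andP[n1 n2].
have T1 : wedge (al s) (be s') <= wedge (al s) (be s) + wedge (be s) (be s').
  by apply: wedge_triangle => //; rewrite /al /be; apply/andP; split; lra.
have T2 : wedge (al s) (be s) <= wedge (al s) (al s') + wedge (al s') (be s).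
  by apply: wedge_triangle => //; rewrite /al /be; apply/andP; split; lra.
have E : rho s * rho s' * wedge (ze s) (ze s') =
    wedge (be s) (be s') + wedge (al s) (al s') + wedge (al s') (be s)
    - wedge (al s) (be s').
  rewrite !wedge_coord.
  have -> : rho s * rho s' * (cos (ze s) / N (ze s) * (sin (ze s') / N (ze s')) -
    sin (ze s) / N (ze s) * (cos (ze s') / N (ze s'))) =
   (rho s / N (ze s) * cos (ze s)) * (rho s' / N (ze s') * sin (ze s')) -
   (rho s / N (ze s) * sin (ze s)) * (rho s' / N (ze s') * cos (ze s')) by ring.
  by rewrite -z1 -z2 -z1' -z2'; ring.
by rewrite -(pmulr_rge0 _ (mulr_gt0 rho0 rho0')) E; lra.
Qed.

(** With [sg = 1] and [m] a lower bound of the products of two chord lengths,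
[m] times the sector swept by the direction of the chord is at most what
[wedge_balance] leaves for the chord; with [sg = -1] and an upper bound it is at
least that. After a half turn every angle has increased by [pi] and all sectors
have the same area. *)
Lemma sector_balance (m sg : R) : `|sg| = 1 ->
  (forall s s', 0 <= s <= pi -> 0 <= s' <= pi ->
     0 <= sg * (rho s * rho s' - m)) ->
  0 <= sg * (1 - r ^+ 2 - t * (1 - t) * m).
Proof.
move=> sg1 rhom; have pi0 := pi_gt0 R.
have t1_gt0 : 0 < 1 - t by rewrite subr_gt0.
have [k k0 kN] := dnorm_ge e_free.
(* During the half turn all angles remain in [[- (3 pi), 3 pi]]. *)
have M0 : 0 < 3 * pi :> R by rewrite mulr_gt0.
have [sigma [C C0 [sigmaP sigma_lt]]] :=
  sector_area_exists k0 kN (dnorm_lipschitz e1 e2) M0.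
have Dh s : 0 <= D s <= pi / 2 by rewrite halfspread_ge0 ?halfspread_le.
have quad f : lipschitz_curve f ->
    (forall s : R, 0 <= s <= pi -> - (3 * pi) <= f s <= 3 * pi) ->
    exists E : R, forall s s', 0 <= s <= pi -> 0 <= s' <= pi ->
      `|sigma (f s') - sigma (f s) - wedge (f s) (f s')| <= E * (s' - s) ^+ 2.
  move=> [l l0 fl] fM; exists (C * l ^+ 2) => s s' s0 s'0.
  apply: (le_trans (sigmaP _ _ (fM _ s0) (fM _ s'0))); rewrite -mulrA ler_wpM2l //.
  rewrite -exprMn -(real_normK (num_real (f s' - f s))).
  rewrite -(real_normK (num_real (l * (s' - s)))) ler_pXn2r ?nnegrE //.
  by rewrite normrM (ger0_norm l0).
have alM s : 0 <= s <= pi -> - (3 * pi) <= al s <= 3 * pi.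
  by have := Dh s; rewrite /al; lra.
have beM s : 0 <= s <= pi -> - (3 * pi) <= be s <= 3 * pi.
  by have := Dh s; rewrite /be; lra.
have omM s : 0 <= s <= pi -> - (3 * pi) <= om s <= 3 * pi.
  by have := polar_lift_close pw qw id s; rewrite ler_norml -/om; lra.
have zeM s : 0 <= s <= pi -> - (3 * pi) <= ze s <= 3 * pi.
  have := polar_lift_close pz qz (fun s => s + pi / 2) s.
  by rewrite ler_norml -/ze; lra.
have [Ea Ha] := quad _ al_lipschitz alM.
have [Eb Hb] := quad _ be_lipschitz beM.
have [Eo Ho] := quad _ om_lipschitz omM.
have [Ez Hz] := quad _ ze_lipschitz zeM.
(* [Phi] is monotone up to quadratic errors, hence monotone; only its values at
[0] and [pi] are used. *)
pose Phi s := t * sigma (al s) + (1 - t) * sigma (be s)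
  - r ^+ 2 * sigma (om s) - t * (1 - t) * m * sigma (ze s).
have [d d0 turn] := chord_turns.
pose E := t * Ea + (1 - t) * Eb + r ^+ 2 * Eo + `|t * (1 - t) * m| * Ez.
have Phi_le : sg * Phi 0 <= sg * Phi pi.
  apply: (@superquadratic_le _ (fun s => sg * Phi s) _ _ E d) => //; first exact: ltW.
  move=> s s' s0 ss' s'pi ss'd.
  have spi : 0 <= s <= pi by apply/andP; split; lra.
  have s'pi' : 0 <= s' <= pi by apply/andP; split; lra.
  have := Ha s s' spi s'pi'; have := Hb s s' spi s'pi'.
  have := Ho s s' spi s'pi'; have := Hz s s' spi s'pi'.
  set q := (s' - s) ^+ 2.
  set ea := sigma (al s') - _ - _; set eb := sigma (be s') - _ - _.
  set eo := sigma (om s') - _ - _; set ez := sigma (ze s') - _ - _.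
  move=> hz ho hb ha.
  have -> : sg * Phi s' - sg * Phi s =
      t * (1 - t) * (sg * (rho s * rho s' - m)) * wedge (ze s) (ze s')
      + sg * (t * ea + (1 - t) * eb - r ^+ 2 * eo - t * (1 - t) * m * ez).
    have bal := wedge_balance s s'.
    rewrite -mulrBr -[t * (1 - t) * (sg * _)]mulrCA -[sg * _ * wedge _ _]mulrA.
    rewrite -mulrDr; congr (sg * _); rewrite /Phi /ea /eb /eo /ez.
    by lra.
  rewrite -[leLHS]add0r lerD //.
    apply: mulr_ge0; last exact: turn.
    by apply: mulr_ge0; [rewrite mulr_ge0 ?(ltW t_gt0) ?(ltW t1_gt0)|exact: rhom].
  rewrite lerNl; apply: (le_trans (ler_norm _)).
  rewrite normrN normrM sg1 mul1r /E !(mulrDl _ _ q).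
  apply: (le_trans (ler_normB _ _)); apply: lerD; last first.
    by rewrite normrM -[leRHS]mulrA ler_wpM2l.
  apply: (le_trans (ler_normB _ _)); apply: lerD; last first.
    by rewrite normrM (ger0_norm (sqr_ge0 r)) -[leRHS]mulrA ler_wpM2l ?sqr_ge0.
  apply: (le_trans (ler_normD _ _)); apply: lerD.
    by rewrite normrM (gtr0_norm t_gt0) -[leRHS]mulrA ler_wpM2l // ltW.
  by rewrite normrM (gtr0_norm t1_gt0) -[leRHS]mulrA ler_wpM2l // ltW.
pose P := sigma (- pi + pi) - sigma (- pi).
have P0 : 0 < P by rewrite subr_gt0 sigma_lt //; lra.
have half x : - pi <= x -> x <= pi -> sigma (x + pi) = sigma x + P.
  move=> xpi pix; rewrite /P (half_turn_area sigmaP _ xpi); last 2 first.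
  - by lra.
  - by lra.
  by rewrite [RHS]addrC subrK.
have shift (f : R -> R) : (forall s, f (s + pi) = f s + pi) -> - pi <= f 0 <= pi ->
    sigma (f pi) = sigma (f 0) + P.
  by move=> fs /andP[f1 f2]; rewrite -[pi in f pi]add0r fs half.
rewrite -(pmulr_lge0 _ P0).
have -> : sg * (1 - r ^+ 2 - t * (1 - t) * m) * P = sg * Phi pi - sg * Phi 0.
  rewrite /Phi (shift al) // ?(shift be) // ?(shift om) // ?(shift ze) //.
  - by ring.
  - have := polar_lift_close pz qz (fun s => s + pi / 2) 0.
    by rewrite ler_norml -/ze; lra.
  - by have := polar_lift_close pw qw id 0; rewrite ler_norml -/om; lra.
  - by have := Dh 0; rewrite /be; lra.
  - by have := Dh 0; rewrite /al; lra.
by rewrite subr_ge0.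
Qed.

(** The least and the greatest chord length along the curve lie on either side
of [eps] by [sector_balance], and the length varies continuously. *)
Lemma exists_chord_at_level (eps : R) : 0 <= eps ->
  r ^+ 2 = 1 - t * (1 - t) * eps ^+ 2 ->
  exists x y : X, [/\ `|x| = 1, `|y| = 1, `|x - y| = eps &
                      `|t *: x + (1 - t) *: y| = r].
Proof.
move=> eps0 rE.
have t1_gt0 : 0 < 1 - t by rewrite subr_gt0.
have tt_gt0 : 0 < t * (1 - t) by rewrite mulr_gt0.
have rho_cont : {within `[0, pi], continuous rho}.
  apply: continuous_subspaceT; apply: lipschitz_continuous; apply: lipschitz_norm.
  have lg := usphere_lipschitz e_free.
  by apply: lipschitzB; apply: (lipschitz_comp lg).
have rho_ge0 s : 0 <= rho s by exact: normr_ge0.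
have [s1 s1pi s1min] := EVT_min (pi_ge0 R) rho_cont.
have [s2 s2pi s2max] := EVT_max (pi_ge0 R) rho_cont.
have inpi s : 0 <= s <= pi -> s \in `[0, pi] by rewrite in_itv.
have min_le : rho s1 <= eps.
  rewrite -(@ler_pXn2r _ 2) ?nnegrE // -(ler_pM2l tt_gt0).
  have := @sector_balance (rho s1 ^+ 2) 1 (normr1 _).
  rewrite !mul1r => bal; have : 0 <= 1 - r ^+ 2 - t * (1 - t) * rho s1 ^+ 2.
    apply: bal => s s' /inpi sp /inpi s'p.
    by rewrite mul1r subr_ge0 expr2 ler_pM ?s1min.
  by rewrite rE; lra.
have max_ge : eps <= rho s2.
  rewrite -(@ler_pXn2r _ 2) ?nnegrE // -(ler_pM2l tt_gt0).
  have := @sector_balance (rho s2 ^+ 2) (-1) (normrN1 _).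
  rewrite !mulN1r => bal; have : 0 <= - (1 - r ^+ 2 - t * (1 - t) * rho s2 ^+ 2).
    apply: bal => s s' /inpi sp /inpi s'p.
    by rewrite mulN1r opprB subr_ge0 expr2 ler_pM ?s2max.
  by rewrite rE; lra.
have attain a b : a <= b -> a \in `[0, pi] -> b \in `[0, pi] ->
    Num.min (rho a) (rho b) <= eps <= Num.max (rho a) (rho b) ->
    exists s, rho s = eps.
  rewrite !in_itv /= => ab /andP[a0 _] /andP[_ bpi] epsab.
  have [|s _ <-] := IVT ab _ epsab; last by exists s.
  apply: continuous_subspaceW rho_cont => x /=; rewrite !in_itv /=.
  by move=> /andP[ax xb]; rewrite (le_trans a0 ax) (le_trans xb bpi).
have [s sE] : exists s, rho s = eps.
  have [s12|/ltW s21] := leP s1 s2.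
    by apply: (attain _ _ s12) => //; rewrite ge_min min_le le_max max_ge orbT.
  by apply: (attain _ _ s21) => //; rewrite ge_min min_le orbT le_max max_ge.
exists (g (al s)), (g (be s)); rewrite !usphere_norm // distrC; split => //.
exact: spread_halfspread.
Qed.

End SectorBalance.

(** * Spaces of dimension at least two and Hilbert spaces *)

Lemma dim_ge2_free (R : realType) (X : lmodType R) : dim_ge 2 X ->
  exists e1 e2 : X, forall a b : R, a *: e1 + b *: e2 = 0 -> a = 0 /\ b = 0.
Proof.
move=> [v vfree]; exists (v ord0), (v (lift ord0 ord0)) => a b ab0.
have := vfree (fun i => if i == ord0 then a else b).
rewrite big_ord_recl big_ord1 /= => /(_ ab0) h.
by have := h ord0; have := h (lift ord0 ord0).
Qed.

(** In the nondegenerate range [`|2t - 1|] is less than the Euclidean value,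
which is less than [1], and [exists_chord_at_level] applies. For [eps = 0] or
[eps = 2] the end points coincide or are antipodal. For [t = 0] or [t = 1] the
division point is an end point, so any chord of length [eps] will do. *)
Lemma exists_euclidean_chord (R : realType) (X : normedModType R) (eps t : R) :
  dim_ge 2 X -> 0 <= eps <= 2 -> 0 <= t <= 1 ->
  exists x y : X, [/\ `|x| = 1, `|y| = 1, `|x - y| = eps &
    `|t *: x + (1 - t) *: y| = Num.sqrt (1 - t * (1 - t) * eps ^+ 2)].
Proof.
move=> /dim_ge2_free[e1 [e2 e_free]] /andP[eps0 eps2] /andP[t0 t1].
have [u u1] : exists u : X, `|u| = 1.
  by exists (usphere e1 e2 0); exact: usphere_norm.
have [epsE|eps_neq2] := eqVneq eps 2.
  exists u, (- u); rewrite normrN u1 opprK -mulr2n -scaler_nat scalerN.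
  rewrite -scalerBl !normrZ u1 !mulr1 epsE normr_nat; split => //.
  by rewrite -sqrtr_sqr; congr Num.sqrt; ring.
have [epsE|eps_neq0] := eqVneq eps 0.
  exists u, u; rewrite u1 subrr normr0 -scalerDl addrC subrK scale1r epsE u1.
  by rewrite expr0n mulr0 subr0 sqrtr1.
have eps_gt0 : 0 < eps by rewrite lt_neqAle eq_sym eps_neq0.
have eps_lt2 : eps < 2 by rewrite lt_neqAle eps_neq2.
have eps_sqr : eps ^+ 2 < 4.
  by have := ltr_pM eps0 eps0 eps_lt2 eps_lt2; rewrite expr2; lra.
have eps_sqr0 : 0 < eps ^+ 2 by rewrite exprn_gt0.
have inner s : 0 < s -> s < 1 -> exists x y : X,
    [/\ `|x| = 1, `|y| = 1, `|x - y| = eps &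
    `|s *: x + (1 - s) *: y| = Num.sqrt (1 - s * (1 - s) * eps ^+ 2)].
  move=> s0 s1; have ss0 : 0 < s * (1 - s) by rewrite mulr_gt0 ?subr_gt0.
  have lo : (2 * s - 1) ^+ 2 < 1 - s * (1 - s) * eps ^+ 2.
    have : s * (1 - s) * eps ^+ 2 < s * (1 - s) * 4 by rewrite ltr_pM2l.
    by rewrite expr2; lra.
  have r0 : 0 <= 1 - s * (1 - s) * eps ^+ 2.
    exact: le_trans (sqr_ge0 _) (ltW lo).
  apply: (exists_chord_at_level e_free s0 s1) => //.
  - by rewrite -sqrtr_sqr ltr_sqrt // (le_lt_trans _ lo) // sqr_ge0.
  - by rewrite -[ltRHS]sqrtr1 ltr_sqrt // gtrDl oppr_lt0 mulr_gt0.
  - by rewrite sqr_sqrtr.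
have [tE|t_neq0] := eqVneq t 0.
  (* Any interior parameter yields a chord of length [eps]. *)
  have [||x [y [x1 y1 xy _]]] := inner 2^-1; rewrite ?invf_lt1 ?ltr1n //.
  exists x, y; split => //.
  by rewrite tE scale0r add0r subr0 scale1r y1 !mul0r subr0 sqrtr1.
have [tE|t_neq1] := eqVneq t 1.
  have [||x [y [x1 y1 xy _]]] := inner 2^-1; rewrite ?invf_lt1 ?ltr1n //.
  exists x, y; split => //.
  by rewrite tE subrr scale0r addr0 scale1r x1 mulr0 mul0r subr0 sqrtr1.
by apply: inner; rewrite lt_neqAle ?t_neq1 // eq_sym t_neq0.
Qed.

(** Stewart's identity for the inner product. *)
Lemma hilbert_comb_norm (R : realType) (H : normedModType R)
    (ip : {dot H for idfun}) (eps t : R) (x y : H) : induces_norm ip ->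
  `|x| = 1 -> `|y| = 1 -> `|x - y| = eps ->
  `|t *: x + (1 - t) *: y| = Num.sqrt (1 - t * (1 - t) * eps ^+ 2).
Proof.
move=> ip_norm x1 y1 <-.
have ip_ge0 z : 0 <= ip z z.
  have [->|z0] := eqVneq z 0; first by rewrite linear0l.
  by apply: ltW; exact: neq0_dnorm_gt0.
have sqE z : ip z z = `|z| ^+ 2 by rewrite ip_norm sqr_sqrtr.
have ipC z w : ip z w = ip w z by rewrite (hermC ip) expr0 mul1r.
have expand (a b : R) : ip (a *: x + b *: y) (a *: x + b *: y) =
    a ^+ 2 + 2 * a * b * ip x y + b ^+ 2.
  have Zl (c : R) z w : ip (c *: z) w = c * ip z w by rewrite linearZl_LR.
  have Zr (c : R) z w : ip z (c *: w) = c * ip z w by rewrite linearZr_LR.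
  rewrite linearDl /= !Zl !linearDr /= !Zr.
  by rewrite (ipC y x) !sqE x1 y1 !expr1n; ring.
rewrite -sqE ip_norm -[x - y](_ : 1 *: x + (- 1) *: y = _); last first.
  by rewrite scale1r scaleN1r.
by rewrite !expand; congr Num.sqrt; ring.
Qed.

(** The norm computation leaves at most one defect; the existence of a chord,
which holds in every normed space of dimension at least two, shows that it
occurs. *)
Lemma convexity_defects_hilbert (R : realType) (H : normedModType R)
    (ip : {dot H for idfun}) (eps t : R) : induces_norm ip -> dim_ge 2 H ->
  0 <= eps <= 2 -> 0 <= t <= 1 ->
  convexity_defects H eps t = [set 1 - Num.sqrt (1 - t * (1 - t) * eps ^+ 2)].
Proof.
move=> ip_norm dimH eps02 t01; apply/seteqP; split => [_ [x [y [x1 y1 xy ->]]]|_ ->] /=.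
  by rewrite (hilbert_comb_norm t ip_norm x1 y1 xy).
by have [x [y [x1 y1 xy <-]]] := exists_euclidean_chord dimH eps02 t01; exists x, y.
Qed.

Lemma convexity_defects_bounds (R : realType) (X : normedModType R) (eps t d : R) :
  0 <= t <= 1 -> convexity_defects X eps t d -> 0 <= d <= 1.
Proof.
move=> /andP[t0 t1] [x [y [x1 y1 _ ->]]]; rewrite subr_ge0 gerBl normr_ge0 andbT.
apply: (le_trans (ler_normD _ _)); rewrite (normrZ t) (normrZ (1 - t)) x1 y1.
by rewrite !ger0_norm ?subr_ge0 // !mulr1 addrC subrK.
Qed.

Unset Implicit Arguments.

Theorem lemma3 (R : realType)
    (X : completeNormedModType R) (dimX : dim_ge 2 X)
    (H : completeNormedModType R) (ip : {dot H for idfun})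
    (ip_norm : induces_norm ip) (dimH : dim_ge 2 H)
    (eps t : R) (eps02 : 0 <= eps <= 2) (t01 : 0 <= t <= 1) :
  [/\ modulus_convexity X eps t <= modulus_convexity H eps t,
      modulus_convexity H eps t = 1 - Num.sqrt (1 - t * (1 - t) * eps ^+ 2),
      1 - Num.sqrt (1 - t * (1 - t) * eps ^+ 2) = modulus_Banas H eps t
    & modulus_Banas H eps t <= modulus_Banas X eps t].
Proof.
have euclid : convexity_defects X eps t (1 - Num.sqrt (1 - t * (1 - t) * eps ^+ 2)).
  by have [x [y [x1 y1 xy <-]]] := exists_euclidean_chord dimX eps02 t01; exists x, y.
rewrite /modulus_convexity /modulus_Banas.
rewrite (convexity_defects_hilbert ip_norm dimH eps02 t01) inf1 sup1; split => //.
- apply: ge_inf => //; exists 0 => d.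
  by move=> /(convexity_defects_bounds t01) /andP[].
- apply: ub_le_sup => //; exists 1 => d.
  by move=> /(convexity_defects_bounds t01) /andP[].
Qed.
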